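(* Let $Z$ be a separable Banach space, let $Y=Z^*$, and let $A:\ell^1\to Y$ be a bounded linear operator which is injective and weak$^*$-to-weak$^*$ continuous. Let $\mu\in[0,1)$ and a real sequence $\{\gamma_n\}_{n\in\mathbb{N}}$ be such that for each $n\in\mathbb{N}$ and each $\xi\in\ell^\infty$ with $\xi_k\in[-1,1]$ for $k\le n$ and $\xi_k=0$ for $k>n$ there exists $\eta\in Y^*$ satisfying (a) $P_nA^*\eta=\xi$, (b) $|[(I-P_n)A^*\eta]_k|\le\mu$ for all $k>n$, (c) $\|\eta\|_{Y^*}\le\gamma_n$. Let $p>1$, $x^\dagger\in\ell^1$, $y=Ax^\dagger$, and let $\varphi$ be the concave index function $$\varphi(t)=2\inf_{n\in\mathbb{N}}\left(\sum_{k=n+1}^\infty|x^\dagger_k|+\gamma_n t\right),\qquad t\ge 0.$$ For noisy data $y^\delta\in Y$ with $\|y-y^\delta\|_Y\le\delta$, $\delta>0$, and $\alpha>0$ let $x_\alpha^\delta$ denote minimizers over $x\in\ell^1$ of $$\frac1p\|Ax-y^\delta\|_Y^p+\alpha\|x\|_{\ell^1}.$$ Then $$\|x_\alpha^\delta-x^\dagger\|_{\ell^1}=O(\varphi(\delta))\quad\text{as }\delta\to0,$$ whenever the regularization parameter $\alpha$ is chosen either a priori as $\alpha=\alpha(\delta)=\delta^p/\varphi(\delta)$, or a posteriori as $\alpha=\alpha_{SDP}(\delta,y^\delta)$ according to the sequential discrepancy principle.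
   Context: All spaces are over the real numbers; $\mathbb{N}=\{1,2,\dots\}$. $\ell^1$ is the space of absolutely summable sequences, $\ell^\infty=(\ell^1)^*$, and $\ell^1=(c_0)^*$. $P_n$ is the projection $P_nx=(x_1,\dots,x_n,0,0,\dots)$ and $[v]_k$ denotes the $k$-th component of a sequence $v$. The weak$^*$ topology on $\ell^1$ is taken with respect to the predual $c_0$, and on $Y$ with respect to the predual $Z$. $A$ is weak$^*$-to-weak$^*$ continuous if $x_n\rightharpoonup^* x_0$ in $\ell^1$ implies $Ax_n\rightharpoonup^* Ax_0$ in $Y$ (sequences). $A^*:Y^*\to\ell^\infty$ is the Banach space adjoint of $A$. An index function is a continuous and strictly increasing function $\varphi:[0,\infty)\to[0,\infty)$ with $\varphi(0)=0$. Sequential discrepancy principle: fix $\tau>1$, $0<q<1$ and $\alpha_0>0$, and let $\Delta_q=\{\alpha_j=q^j\alpha_0: j=1,2,\dots\}$. Given $\delta>0$ and $y^\delta$, the parameter $\alpha=\alpha_{SDP}(\delta,y^\delta)$ is chosen in $\Delta_q$ such that $\|Ax_\alpha^\delta-y^\delta\|_Y\le\tau\delta<\|Ax_{\alpha/q}^\delta-y^\delta\|_Y$; the assertion concerns parameters satisfying this. The $O$-statement means: there are constants $C,\overline\delta>0$ (independent of $\delta$ and $y^\delta$) such that the error is at most $C\varphi(\delta)$ for all $0<\delta\le\overline\delta$ and all $y^\delta$ with $\|y-y^\delta\|_Y\le\delta$ and the parameter chosen as described. *)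

(* Defs.v *)
From HB Require Import structures.
From mathcomp Require Import all_boot all_order all_algebra.
From mathcomp Require Import all_classical all_reals all_analysis.

Set Implicit Arguments.
Unset Strict Implicit.
Unset Printing Implicit Defensive.

Import Order.TTheory GRing.Theory Num.Theory.
Import numFieldNormedType.Exports.

Local Open Scope classical_set_scope.
Local Open Scope ring_scope.

(* Indices start at 0: the k-th component of a sequence in the usual 1-based  *)
(* numbering is its value at k - 1.  Hence "k <= n" reads [(k < n)%N], and    *)
(* the sum over k >= n + 1 is a sum over the 0-based indices k >= n.          *)

Section bounded_operators.
Context {R : realType} (U V : normedModType R).

Definition bounded_linear : {pred U -> V} :=
  [pred f | `[< linear f /\ exists M : R, forall x, `|f x| <= M * `|x| >]].

Record boundedOp := BoundedOp {
  boundedOp_fun :> U -> V ;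
  boundedOp_prop : boundedOp_fun \in bounded_linear }.

HB.instance Definition _ := [isSub for boundedOp_fun].
HB.instance Definition _ := [Choice of boundedOp by <:].

Lemma bounded_linearP (f : U -> V) :
  reflect (linear f /\ exists2 M : R, 0 <= M & forall x, `|f x| <= M * `|x|)
          (f \in bounded_linear).
Proof.
rewrite unfold_in /=; apply: (iffP (asboolP _)) => [[lf [M fM]]|[lf [M _ fM]]].
  split => //; exists `|M| => // x.
  by rewrite (le_trans (fM x)) // ler_wpM2r // ler_norm.
by split => //; exists M.
Qed.

Lemma boundedOp_linear (f : boundedOp) : linear f.
Proof. by have /bounded_linearP[] := boundedOp_prop f. Qed.

HB.instance Definition _ (f : boundedOp) :=
  GRing.isLinear.Build R U V *:%R f (boundedOp_linear f).

Lemma bounded_linear_submod : submod_closed bounded_linear.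
Proof.
split.
  apply/bounded_linearP; split; first by move=> a x y /=; rewrite scaler0 addr0.
  by exists 0 => // x; rewrite normr0 mul0r.
move=> a f g /bounded_linearP[lf [M M0 fM]] /bounded_linearP[lg [N N0 gN]].
apply/bounded_linearP; split.
  move=> b x y; rewrite !fctE lf lg.
  by rewrite !scalerDr !scalerA mulrC addrACA.
exists (`|a| * M + N); first by rewrite addr_ge0 ?mulr_ge0.
move=> x; rewrite (le_trans (ler_normD _ _)) // mulrDl lerD //.
by rewrite normrZ -mulrA ler_wpM2l.
Qed.

HB.instance Definition _ :=
  GRing.isSubmodClosed.Build _ _ bounded_linear bounded_linear_submod.
HB.instance Definition _ := [SubChoice_isSubLmodule of boundedOp by <:].

Definition opnorm (f : boundedOp) : R :=
  sup [set `|f x| | x in [set x : U | `|x| <= 1]].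

Lemma opnorm_has_sup (f : boundedOp) :
  has_sup [set `|f x| | x in [set x : U | `|x| <= 1]].
Proof.
split; first by exists `|f 0|, 0 => //=; rewrite normr0.
have /bounded_linearP[_ [M M0 fM]] := boundedOp_prop f.
exists M => _ [x /= x1 <-]; rewrite (le_trans (fM x)) //.
by rewrite -[leRHS]mulr1 ler_wpM2l.
Qed.

Lemma opnorm_ge (f : boundedOp) (x : U) : `|x| <= 1 -> `|f x| <= opnorm f.
Proof. by move=> x1; apply: sup_upper_bound; [exact: opnorm_has_sup|exists x]. Qed.

Lemma opnorm_le (f : boundedOp) (M : R) :
  (forall x, `|x| <= 1 -> `|f x| <= M) -> opnorm f <= M.
Proof.
move=> fM; apply: ge_sup; first exact: (opnorm_has_sup f).1.
by move=> _ [x /= x1 <-]; exact: fM.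
Qed.

Lemma opnorm_ge0 (f : boundedOp) : 0 <= opnorm f.
Proof. by rewrite (le_trans _ (@opnorm_ge f 0 _)) // normr0. Qed.

Lemma opnormP (f : boundedOp) (x : U) : `|f x| <= opnorm f * `|x|.
Proof.
have [->|x0] := eqVneq x 0; first by rewrite linear0 !normr0 mulr0.
have nx : 0 < `|x| by rewrite normr_gt0.
have := @opnorm_ge f (`|x|^-1 *: x); rewrite linearZ !normrZ ger0_norm ?invr_ge0 //.
by rewrite mulVf ?gt_eqF // => /(_ (lexx _)); rewrite mulrC ler_pdivrMr.
Qed.

Lemma opnormD (f g : boundedOp) : opnorm (f + g) <= opnorm f + opnorm g.
Proof.
apply: opnorm_le => x x1; rewrite (le_trans (ler_normD _ _)) //.
by rewrite lerD ?opnorm_ge.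
Qed.

Lemma opnormZ (a : R) (f : boundedOp) : opnorm (a *: f) = `|a| * opnorm f.
Proof.
have le_opnormZ (b : R) (g : boundedOp) : opnorm (b *: g) <= `|b| * opnorm g.
  by apply: opnorm_le => x x1; rewrite normrZ ler_wpM2l ?opnorm_ge.
apply/eqP; rewrite eq_le le_opnormZ /=.
have [->|a0] := eqVneq a 0; first by rewrite normr0 mul0r opnorm_ge0.
rewrite mulrC -ler_pdivlMr ?normr_gt0 // mulrC -normfV.
by rewrite -{1}(scale1r f) -(mulVf a0) -scalerA.
Qed.

Lemma opnorm_eq0 (f : boundedOp) : opnorm f = 0 -> f = 0.
Proof.
move=> f0; apply/val_inj/funext => x; apply/eqP.
by rewrite -normr_le0 (le_trans (opnormP f x)) // f0 mul0r.
Qed.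

HB.instance Definition _ :=
  Lmodule_isNormed.Build R boundedOp opnormD opnormZ opnorm_eq0.

End bounded_operators.
Arguments bounded_linear {R} U V.
Arguments boundedOp {R} U V.

Definition dual {R : realType} (U : normedModType R) : normedModType R :=
  boundedOp U R^o.

Section adjoint.
Context {R : realType} {U V : normedModType R}.
Variable A : boundedOp U V.

Lemma adjoint_subproof (eta : dual V) :
  (fun x => eta (A x)) \in bounded_linear U R^o.
Proof.
have /bounded_linearP[_ [M M0 AM]] := boundedOp_prop A.
have /bounded_linearP[_ [N N0 eN]] := boundedOp_prop eta.
apply/bounded_linearP; split; first by move=> a x y; rewrite !linearP.
exists (N * M); first by rewrite mulr_ge0.
by move=> x; rewrite (le_trans (eN _)) // -mulrA ler_wpM2l.
Qed.

Definition adjoint (eta : dual V) : dual U := BoundedOp (adjoint_subproof eta).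

End adjoint.

Section ell1.
Context {R : realType}.

Definition summable_seq : {pred nat -> R^o} :=
  [pred u : nat -> R^o | `[< cvgn [normed series u] >]].

Record ell1 := Ell1 {
  ell1_seq :> nat -> R^o ;
  ell1_prop : ell1_seq \in summable_seq }.

HB.instance Definition _ := [isSub for ell1_seq].
HB.instance Definition _ := [Choice of ell1 by <:].

Lemma ell1_cvg (x : ell1) : cvgn [normed series x].
Proof. exact/asboolP/(ell1_prop x). Qed.

Lemma normed_seriesZ (a : R) (u : nat -> R^o) :
  [normed series (a *: u)] = `|a| *: ([normed series u] : nat -> R^o).
Proof. by rewrite -seriesZ; congr series; apply/funext => k; rewrite /= normrM. Qed.

Lemma is_cvg_normed_seriesD (u v : nat -> R^o) :
  cvgn [normed series u] -> cvgn [normed series v] ->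
  cvgn [normed series (u + v)].
Proof.
move=> cu cv; apply: (@series_le_cvg R _ ((fun k => `|u k|) + (fun k => `|v k|))).
- by move=> k /=.
- by move=> k /=; rewrite addr_ge0.
- by move=> k /=; exact: ler_normD.
- exact: is_cvg_seriesD.
Qed.

Lemma summable_seq_submod : submod_closed summable_seq.
Proof.
split.
  apply/asboolP; rewrite -(scale0r (0 : nat -> R^o)) normed_seriesZ normr0 scale0r.
  exact: is_cvg_cst.
move=> a u v /asboolP cu /asboolP cv; apply/asboolP.
apply: is_cvg_normed_seriesD => //; rewrite normed_seriesZ.
exact: is_cvgZr.
Qed.

HB.instance Definition _ :=
  GRing.isSubmodClosed.Build _ _ summable_seq summable_seq_submod.
HB.instance Definition _ := [SubChoice_isSubLmodule of ell1 by <:].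

Definition ell1_norm (x : ell1) : R := limn [normed series x].

Lemma ell1_normD (x y : ell1) : ell1_norm (x + y) <= ell1_norm x + ell1_norm y.
Proof.
rewrite /ell1_norm -[leRHS](lim_seriesD (@ell1_cvg x) (@ell1_cvg y)).
apply: lim_series_le => [||k]; first exact: ell1_cvg.
- by apply: is_cvg_seriesD; exact: ell1_cvg.
- exact: ler_normD.
Qed.

Lemma ell1_normZ (a : R) (x : ell1) : ell1_norm (a *: x) = `|a| * ell1_norm x.
Proof.
rewrite /ell1_norm -[LHS]/(limn [normed series (a *: (x : nat -> R^o))]).
by rewrite normed_seriesZ limZr //; exact: ell1_cvg.
Qed.

Lemma ell1_norm_ge (x : ell1) (k : nat) : `|x k| <= ell1_norm x.
Proof.
have nd : nondecreasing_seq [normed series x].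
  by apply/nondecreasing_seqP => n; rewrite /= /series /= big_nat_recr //= lerDl.
apply: le_trans (nondecreasing_cvgn_le nd (@ell1_cvg x) k.+1).
by rewrite /= /series /= big_nat_recr //= lerDr sumr_ge0.
Qed.

Lemma ell1_norm_eq0 (x : ell1) : ell1_norm x = 0 -> x = 0.
Proof.
move=> x0; apply/val_inj/funext => k; apply/eqP.
by rewrite -normr_le0 -x0 ell1_norm_ge.
Qed.

HB.instance Definition _ :=
  Lmodule_isNormed.Build R ell1 ell1_normD ell1_normZ ell1_norm_eq0.

Definition tail_sum (x : ell1) (n : nat) : R :=
  limn (fun m => \sum_(n <= k < m) `|x k|).

Lemma ell1_unit_subproof (k : nat) :
  (fun j => (j == k)%:R) \in summable_seq.
Proof.
apply/asboolP/cvg_ex; exists 1; apply: cvg_near_cst; near=> n.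
rewrite /= /series /= (big_nat_widenl 0 0) //= (bigD1_seq k) ?iota_uniq //=; last first.
  by rewrite mem_index_iota /=; near: n; exact: nbhs_infty_gt.
by rewrite eqxx normr1 big1 ?addr0 // => j /negbTE ->; rewrite normr0.
Unshelve. all: by end_near. Qed.

Definition ell1_unit (k : nat) : ell1 := Ell1 (ell1_unit_subproof k).

(* The sequence representing a functional under the isometric isomorphism     *)
(* (l^1)^* = l^oo; by [ell1_dualE], f is the pairing with this sequence.      *)
Definition ell1_dual_seq (f : dual ell1) : nat -> R := fun k => f (ell1_unit k).

Lemma ell1_subE (x y : ell1) (k : nat) : (x - y) k = x k - y k.
Proof. by []. Qed.

Lemma ell1_normE (x : ell1) : `|x| = limn [normed series x].
Proof. by []. Qed.

Lemma ell1_partialE (x : ell1) (n j : nat) :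
  (\sum_(0 <= k < n) x k *: ell1_unit k) j = if (j < n)%N then x j else 0.
Proof.
elim: n => [|n IHn]; first by rewrite big_geq.
rewrite big_nat_recr //= -[LHS]/(_ j + x n * (j == n)%:R) IHn ltnS (leq_eqVlt j).
case: (eqVneq j n) => [->|_] /=; first by rewrite ltnn add0r mulr1.
by rewrite mulr0 addr0.
Qed.

Lemma ell1_partial_dist (x : ell1) (n : nat) :
  `|x - \sum_(0 <= k < n) x k *: ell1_unit k| = `|x| - [normed series x] n.
Proof.
set d := x - _.
have dE j : d j = if (j < n)%N then 0 else x j.
  by rewrite ell1_subE ell1_partialE; case: ifP; rewrite ?subrr ?subr0.
clearbody d; rewrite [LHS]ell1_normE.
apply/cvg_lim => //; have := @ell1_cvg x => cx.
have : ([normed series x] m - [normed series x] n) @[m --> \oo]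
    --> `|x| - [normed series x] n by apply: cvgB => //; exact: cvg_cst.
apply: cvg_trans; apply: near_eq_cvg; near=> m.
have nm : (n <= m)%N by near: m; exact: nbhs_infty_ge.
have split_sum (u : nat -> R^o) :
    [normed series u] m = [normed series u] n + \sum_(n <= k < m) `|u k|.
  by rewrite /= /series /= (big_cat_nat _ nm).
have head0 : [normed series d] n = 0.
  rewrite /= /series /= big_nat_cond big1 // => k /andP[/andP[_ kn] _].
  by rewrite dE kn normr0.
rewrite (split_sum x) (split_sum d) head0 add0r [LHS]addrAC subrr add0r.
by apply: eq_big_nat => k /andP[nk _]; rewrite dE ltnNge nk.
Unshelve. all: by end_near. Qed.

Lemma ell1_dualE (f : dual ell1) (x : ell1) :
  series (fun k => ell1_dual_seq f k * x k) @ \oo --> (f x : R).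
Proof.
have cx : `|x| - [normed series x] n @[n --> \oo] --> (0 : R).
  rewrite -[X in _ --> X](subrr `|x|); apply: cvgB; first exact: cvg_cst.
  exact: (@ell1_cvg x).
have c0 : opnorm f * (`|x| - [normed series x] n) @[n --> \oo] --> (0 : R).
  by have := cvgM (cvg_cst (opnorm f)) cx; rewrite mulr0; exact.
apply/cvgrPdist_le => e e0; near=> n.
rewrite (_ : series _ n = f (\sum_(0 <= k < n) x k *: ell1_unit k)); last first.
  rewrite linear_sum; apply: eq_bigr => k _; rewrite linearZ /=.
  by rewrite /ell1_dual_seq mulrC.
rewrite -linearB (le_trans (opnormP f _)) // ell1_partial_dist.
rewrite (le_trans (ler_norm _)) // -normrN -sub0r.
by near: n; move/cvgrPdist_le: c0; exact.
Unshelve. all: by end_near. Qed.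

(* The predual c_0 acts on l^1 by x |-> sum_k c_k x_k. *)
Definition weak_star_cvg_ell1 (x : nat -> ell1) (x0 : ell1) : Prop :=
  forall c : nat -> R, c @ \oo --> (0 : R) ->
    limn (series (fun k => c k * x n k)) @[n --> \oo]
      --> limn (series (fun k => c k * x0 k)).

Definition proj_seq (n : nat) (v : nat -> R) : nat -> R :=
  fun k => if (k < n)%N then v k else 0.

End ell1.
Arguments ell1 R : clear implicits.

Definition weak_star_cvg_dual {R : realType} {Z : normedModType R}
    (f : nat -> dual Z) (f0 : dual Z) : Prop :=
  forall z : Z, f n z @[n --> \oo] --> (f0 z : R).

Definition weak_star_continuous {R : realType} {Z : normedModType R}
    (A : ell1 R -> dual Z) : Prop :=
  forall (x : nat -> ell1 R) (x0 : ell1 R),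
    weak_star_cvg_ell1 x x0 -> weak_star_cvg_dual (A \o x) (A x0).

Definition separable {R : realType} (Z : normedModType R) : Prop :=
  exists S : set Z, countable S /\ dense S.

Definition index_function {R : realType} (phi : R -> R) : Prop :=
  [/\ phi 0 = 0,
      (forall t, 0 <= t -> 0 <= phi t),
      {within `[0, +oo[, continuous phi} &
      {in `[0, +oo[ &, {homo phi : s t / s < t}}].

Definition concave_function {R : realType} (phi : R -> R) : Prop :=
  convex_function (`[0, +oo[%classic : set R^o) (fun t : R^o => - phi t).

Section tikhonov.
Context {R : realType} {Y : normedModType R}.
Variables (A : ell1 R -> Y) (p : R) (ydelta : Y).

Definition tikhonov (alpha : R) (x : ell1 R) : R :=
  p^-1 * `|A x - ydelta| `^ p + alpha * `|x|.

Definition tikhonov_minimizer (alpha : R) (x : ell1 R) : Prop :=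
  forall z : ell1 R, tikhonov alpha x <= tikhonov alpha z.

(* Minimizers need not be unique: both discrepancies refer to given           *)
(* minimizers x for alpha and x' for alpha / q.                               *)
Definition sdp_choice (tau q alpha0 delta alpha : R) (x : ell1 R) : Prop :=
  (exists2 j : nat, (0 < j)%N & alpha = q ^+ j * alpha0) /\
  exists2 x' : ell1 R, tikhonov_minimizer (alpha / q) x' &
    `|A x - ydelta| <= tau * delta < `|A x' - ydelta|.

End tikhonov.

(* The infimum runs over n >= 1; the value gamma 0 is never used. *)
Definition rate_function {R : realType} (x : ell1 R) (gamma : nat -> R)
    (t : R) : R :=
  2 * inf [set tail_sum x n + gamma n * t | n in [set n | (0 < n)%N]].

(* Main.v *)
(* Testing A (x - xdag) against the functional eta that belongs to the signs of
   the first n components of x - xdag gives the variational inequality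
     |x - xdag| <= K (|x| - |xdag| + phi |A (x - xdag)|),
   with K = (1 + mu) / (1 - mu).  Minimality bounds |x| - |xdag| by
   (delta^p / alpha) (1 - s^p) / p for s = |A x - ydelta| / delta, and since
   phi t / t is nonincreasing, phi |A (x - xdag)| <= (s + 1) phi delta.  For the
   a priori choice Young's inequality s <= s^p / p + 1 - 1 / p absorbs the term
   in s.  For the discrepancy principle s <= tau, and applying the same two
   bounds at alpha / q, where s > tau, yields delta^p / alpha = O(phi delta). *)

Require Import Defs.
From HB Require Import structures.
From mathcomp Require Import all_boot all_order all_algebra.
From mathcomp Require Import all_classical all_reals all_analysis.
From mathcomp Require Import ring lra.
Import Order.TTheory GRing.Theory Num.Theory.
Import numFieldNormedType.Exports.
Local Open Scope classical_set_scope.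
Local Open Scope ring_scope.

Set Implicit Arguments.
Unset Strict Implicit.

(** * Heads and tails of absolutely summable series *)

Section ell1_partial_sums.
Context {R : realType}.
Implicit Types x z : ell1 R.

Lemma normed_series_le_norm x n : [normed series x] n <= `|x|.
Proof. by rewrite -subr_ge0 -ell1_partial_dist. Qed.

Lemma normed_series_cat x n m : (n <= m)%N ->
  [normed series x] m = [normed series x] n + \sum_(n <= k < m) `|x k|.
Proof. by move=> nm; rewrite /= /series /= (big_cat_nat _ nm). Qed.

Lemma tail_sumE x n : tail_sum x n = `|x| - [normed series x] n.
Proof.
apply/cvg_lim => //.
have : [normed series x] m - [normed series x] n @[m --> \oo]
    --> `|x| - [normed series x] n.
  by apply: cvgB; [exact: (@ell1_cvg R x)|exact: cvg_cst].
apply: cvg_trans; apply: near_eq_cvg; near=> m.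
by rewrite (@normed_series_cat x n m) 1?addrAC ?subrr ?add0r //;
  near: m; exact: nbhs_infty_ge.
Unshelve. all: by end_near. Qed.

Lemma tail_sum_ge0 x n : 0 <= tail_sum x n.
Proof. by rewrite tail_sumE subr_ge0 normed_series_le_norm. Qed.

Lemma tail_sum_cvg0 x : tail_sum x n @[n --> \oo] --> (0 : R).
Proof.
under eq_fun do rewrite tail_sumE.
rewrite -(subrr `|x|); apply: cvgB; first exact: cvg_cst.
exact: (@ell1_cvg R x).
Qed.

(** A tail is the norm of a vector minus its truncation, and truncation is linear, so the triangle
    inequality of the norm applies. *)
Lemma tail_sum_subB x z n : tail_sum (x - z) n <= tail_sum x n + tail_sum z n.
Proof.
rewrite !tail_sumE -!ell1_partial_dist.
set P := fun u : ell1 R => \sum_(0 <= k < n) u k *: ell1_unit k.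
have PB : P (x - z) = P x - P z.
  by rewrite /P -sumrB; apply: eq_bigr => k _; rewrite ell1_subE scalerBl.
rewrite -/(P (x - z)) -/(P x) -/(P z) PB.
by rewrite opprD addrACA -opprD ler_normB.
Qed.

Lemma normed_series_leB x z n :
  [normed series z] n <= [normed series x] n + [normed series (x - z)] n.
Proof.
rewrite /= /series /= -big_split /=; apply: ler_sum => k _.
have -> : z k = x k - (x - z) k by rewrite ell1_subE subKr.
exact: ler_normB.
Qed.

End ell1_partial_sums.

(** * From a source element to a variational inequality *)

Section source_element.
Context {R : realType} {Y : normedModType R} (A : boundedOp (ell1 R) Y).

(** In [eta (A d)] the first [n] terms sum to the head of [|d|], and the others lose at most [mu]
    times the tail, which is [|d|] minus the head. *)
Lemma source_head_le (mu : R) (n : nat) (eta : dual Y) (d : ell1 R) :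
  (forall k, (k < n)%N -> ell1_dual_seq (adjoint A eta) k = Num.sg (d k)) ->
  (forall k, (n <= k)%N -> `|ell1_dual_seq (adjoint A eta) k| <= mu) ->
  (1 + mu) * [normed series d] n <= `|eta| * `|A d| + mu * `|d|.
Proof.
move=> head tail; set a := ell1_dual_seq _ in head tail.
rewrite -lerBlDr; apply: (le_trans _ (opnormP eta (A d))).
apply: (le_trans _ (ler_norm _)).
(* The estimate is shown for partial sums up to [m >= n] and passed to the limit in [m]. *)
have lhs : (1 + mu) * [normed series d] n - mu * [normed series d] m
    @[m --> \oo] --> (1 + mu) * [normed series d] n - mu * `|d|.
  apply: cvgB; first exact: cvg_cst.
  by apply: cvgM; [exact: cvg_cst|exact: (@ell1_cvg R d)].
have rhs := @ell1_dualE R (adjoint A eta) d.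
apply: (ler_cvg_to lhs rhs); near=> m.
have nm : (n <= m)%N by near: m; exact: nbhs_infty_ge.
rewrite (normed_series_cat _ nm) mulrDr opprD addrA -mulrBl addrK mul1r.
rewrite -/a (_ : series _ m = series (fun k => a k * d k) n
  + \sum_(n <= k < m) a k * d k); last by rewrite /series /= (big_cat_nat _ nm).
apply: lerD.
  rewrite /series /=; apply: ler_sum_nat => k /andP[_ kn].
  by rewrite head // normrEsg.
rewrite mulr_sumr -sumrN; apply: ler_sum_nat => k /andP[nk _].
by rewrite lerNl (le_trans (ler_norm _)) // normrN normrM ler_wpM2r // tail.
Unshelve. all: by end_near. Qed.

Lemma source_variational_le (mu g : R) (n : nat) (eta : dual Y)
    (x z : ell1 R) : 0 <= mu < 1 ->
  (forall k, (k < n)%N ->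
    ell1_dual_seq (adjoint A eta) k = Num.sg ((x - z) k)) ->
  (forall k, (n <= k)%N -> `|ell1_dual_seq (adjoint A eta) k| <= mu) ->
  `|eta| <= g ->
  (1 - mu) * `|x - z| <=
    (1 + mu) * (`|x| - `|z| + 2 * (tail_sum z n + g * `|A (x - z)|)).
Proof.
move=> /andP[mu0 mu1] head tail etag.
have := @source_head_le mu n eta (x - z) head tail.
have : `|eta| * `|A (x - z)| <= g * `|A (x - z)| by rewrite ler_wpM2r.
have : 0 <= g * `|A (x - z)| by rewrite mulr_ge0 // (le_trans _ etag).
have := tail_sum_subB x z n; have := normed_series_leB x z n.
rewrite !tail_sumE.
move: (g * _) (`|eta| * _) => u v.
move: ([normed series (x - z)] n) ([normed series x] n) ([normed series z] n).
move: `|x - z| `|x| `|z| => D X Z P SX SZ h1 h2 u0 vu h3.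
have : 0 <= mu * u by rewrite mulr_ge0.
(* This combines the triangle inequalities for head and tail. By [h3], [2 * (1 + mu) * P] costs at
   most [2 * u + 2 * mu * D]; moving the [D] term to the left leaves the factor [1 - mu]. *)
have : (1 + mu) * D <= (1 + mu) * (2 * P + X - Z + 2 * (Z - SZ)).
  by rewrite ler_wpM2l //; lra.
nra.
Qed.

End source_element.

(** * The rate function when [gamma] is bounded below by a positive constant *)

Section rate_function.
Context {R : realType} (x : ell1 R) (gamma : nat -> R) (c : R).
Hypotheses (c_gt0 : 0 < c) (gamma_ge : forall n, (0 < n)%N -> c <= gamma n).

Let F := rate_function x gamma.

Lemma rate_function_le n t : (0 < n)%N -> 0 <= t ->
  F t <= 2 * (tail_sum x n + gamma n * t).
Proof.
move=> n0 t0; rewrite /F /rate_function ler_pM2l //;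
  apply: ge_inf; last by exists n.
exists 0 => _ [m /= m0 <-]; rewrite addr_ge0 ?tail_sum_ge0 // mulr_ge0 //.
exact: le_trans (ltW c_gt0) (gamma_ge m0).
Qed.

Lemma le_rate_function s t :
  (forall n, (0 < n)%N -> s <= 2 * (tail_sum x n + gamma n * t)) -> s <= F t.
Proof.
move=> h; rewrite /F /rate_function -ler_pdivrMl //.
apply: lb_le_inf; first by exists (tail_sum x 1 + gamma 1 * t), 1%N.
by move=> _ [n /= n0 <-]; rewrite ler_pdivrMl // h.
Qed.

Lemma rate_function_ge0 t : 0 <= t -> 0 <= F t.
Proof.
move=> t0; apply: le_rate_function => n n0.
by rewrite mulr_ge0 // addr_ge0 ?tail_sum_ge0 // mulr_ge0
  // (le_trans (ltW c_gt0)) ?gamma_ge.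
Qed.

(** Every affine function under the infimum has slope at least [c]. This yields strict monotonicity
    and positivity. *)
Lemma rate_function_slope s t : 0 <= s <= t -> F s + 2 * c * (t - s) <= F t.
Proof.
move=> /andP[s0 st]; apply: le_rate_function => n n0.
have := rate_function_le n0 s0.
have : c * (t - s) <= gamma n * (t - s).
  by rewrite ler_wpM2r ?subr_ge0 // gamma_ge.
lra.
Qed.

Lemma rate_function_homo s t : 0 <= s <= t -> F s <= F t.
Proof.
move=> st; have := rate_function_slope st; apply: le_trans; rewrite lerDl.
by case/andP: st => s0 st; rewrite mulr_ge0 ?subr_ge0 // mulr_ge0 // ltW.
Qed.

Lemma rate_function_gt0 t : 0 < t -> 0 < F t.
Proof.
move=> t0; have := @rate_function_slope 0 t; rewrite lexx ltW //= => /(_ isT).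
have := rate_function_ge0 (lexx _); have := mulr_gt0 c_gt0 t0; lra.
Qed.

(** This is the monotonicity of [F t / t], free of division so as to include [t = 0]: each
    [tail_sum x n / t + gamma n] is nonincreasing in [t]. *)
Lemma rate_function_scale s t : 0 <= t <= s -> t * F s <= s * F t.
Proof.
move=> /andP[t0 ts]; have s0 := le_trans t0 ts.
have [->|tn0] := eqVneq t 0; first by rewrite mul0r mulr_ge0 ?rate_function_ge0.
have sp : 0 < s by rewrite (lt_le_trans _ ts) // lt_neqAle eq_sym tn0.
rewrite -ler_pdivrMl //; apply: le_rate_function => n n0.
rewrite ler_pdivrMl // (le_trans (ler_wpM2l t0 (rate_function_le n0 s0))) //.
have := ler_wpM2r (tail_sum_ge0 x n) ts; lra.
Qed.

Lemma rate_function0 : F 0 = 0.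
Proof.
apply/eqP; rewrite eq_le rate_function_ge0 // andbT; apply/ler_addgt0Pl => e e0.
(* At 0 only the tails remain. The index [N.+1] is taken because the infimum starts at 1. *)
have /cvgrPdist_le/(_ (e / 2)) := @tail_sum_cvg0 _ x.
rewrite divr_gt0 // => /(_ isT) [N _ /(_ N.+1 (leqnSn N))].
rewrite sub0r normrN ger0_norm ?tail_sum_ge0 // => he.
have := @rate_function_le N.+1 0 isT (lexx _); lra.
Qed.

Lemma rate_function_near0 e : 0 < e ->
  exists2 d, 0 < d & forall t, 0 <= t <= d -> F t <= e.
Proof.
move=> e0; have /cvgrPdist_le/(_ (e / 4)) := @tail_sum_cvg0 _ x.
rewrite divr_gt0 // => /(_ isT) [N _ /(_ N.+1 (leqnSn N))].
rewrite sub0r normrN ger0_norm ?tail_sum_ge0 // => he.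
have g0 : 0 < gamma N.+1 by exact: lt_le_trans (gamma_ge _).
(* Tail and noise term are each at most [e / 4], and the rate function doubles their sum. *)
exists (e / (4 * gamma N.+1)); first by rewrite divr_gt0 // mulr_gt0.
move=> t /andP[t0]; rewrite ler_pdivlMr ?mulr_gt0 // => td.
have := @rate_function_le N.+1 t isT t0; lra.
Qed.

(** Comparing [F s] with [(s / t) * F t] through [rate_function_scale] controls the increment on
    either side of [t]; this gives continuity at positive points. *)
Lemma rate_function_dist s t : 0 <= s -> 0 < t ->
  `|F t - F s| <= `|t - s| * (F t / t).
Proof.
move=> s0 t0; rewrite mulrA ler_pdivlMr //.
have [st|ts] := leP s t.
  have sct := @rate_function_scale t s; have := @rate_function_homo s t.
  rewrite s0 st in sct * => /(_ isT) hom; rewrite !ger0_norm ?subr_ge0 //.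
  have := sct isT; lra.
have := @rate_function_scale s t; have := @rate_function_homo t s.
rewrite (ltW t0) (ltW ts) => /(_ isT) hom /(_ isT) sct.
rewrite !ler0_norm ?subr_le0 // ?(ltW ts) //; lra.
Qed.

Lemma rate_function_continuous : {within `[0, +oo[, continuous F}.
Proof.
apply/subspace_continuousP => t /=; rewrite in_itv /= andbT le_eqVlt.
move=> /predU1P[<-|t0]; apply/cvgrPdist_le => e e0.
  have [d d0 Fd] := rate_function_near0 e0.
  rewrite near_withinE; near=> s => /=; rewrite in_itv /= andbT => s0;
    rewrite /from_subspace.
  rewrite rate_function0 sub0r normrN ger0_norm ?rate_function_ge0
    // Fd // s0 /=.
  rewrite -[leLHS]ger0_norm // -normrN -sub0r ltW //.
rewrite near_withinE; near=> s => /=; rewrite in_itv /= andbT => s0;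
  rewrite /from_subspace.
apply: (le_trans (rate_function_dist s0 t0)).
rewrite -ler_pdivlMr ?divr_gt0 ?rate_function_gt0 // ltW //.
near: s; apply: nbhsx_ballx; rewrite divr_gt0 // divr_gt0 // rate_function_gt0.
Unshelve. all: by end_near. Qed.

(** An infimum of affine functions is concave. *)
Lemma rate_function_concave s t l : 0 <= s -> 0 <= t -> 0 <= l <= 1 ->
  l * F s + (1 - l) * F t <= F (l * s + (1 - l) * t).
Proof.
move=> s0 t0 /andP[l0 l1]; apply: le_rate_function => n n0.
have := ler_wpM2l l0 (rate_function_le n0 s0).
have l1' : 0 <= 1 - l by lra.
have := ler_wpM2l l1' (rate_function_le n0 t0); lra.
Qed.

End rate_function.

(** * Transfer to a function known only on the nonnegative half-line *)

Section index_function_of_rate.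
Context {R : realType} (x : ell1 R) (gamma : nat -> R) (c : R) (phi : R -> R).
Hypotheses (c_gt0 : 0 < c) (gamma_ge : forall n, (0 < n)%N -> c <= gamma n)
  (phiE : forall t, 0 <= t -> phi t = rate_function x gamma t).

Lemma rate_index_function : index_function phi.
Proof.
split.
- by rewrite phiE // (rate_function0 x c_gt0).
- by move=> t t0; rewrite phiE // (rate_function_ge0 x c_gt0).
- have := @rate_function_continuous _ x _ _ c_gt0 gamma_ge.
  apply: subspace_eq_continuous => t; rewrite inE /= in_itv /= andbT => t0.
  by rewrite /from_subspace phiE.
- move=> s t; rewrite !in_itv /= !andbT => s0 t0 st; rewrite !phiE //.
  have := @rate_function_slope _ x _ _ c_gt0 gamma_ge s t.
  rewrite s0 ltW // => /(_ isT); apply: lt_le_trans.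
  by rewrite ltrDl mulr_gt0 ?subr_gt0 // mulr_gt0.
Qed.

Lemma rate_concave_function : concave_function phi.
Proof.
move=> l s t; rewrite !inE /= !in_itv /= !andbT => s0 t0.
have /andP[l0 l1] : 0 <= l%:num <= 1 by rewrite ge0 le1.
have := @rate_function_concave _ x _ _ c_gt0 gamma_ge s t l%:num s0 t0.
rewrite l0 l1 => /(_ isT) conc; rewrite !convRE /= lerNl opprD !mulrN !opprK.
rewrite !phiE //.
by rewrite addr_ge0 ?mulr_ge0 ?subr_ge0.
Qed.

End index_function_of_rate.

(** * Error bounds for Tikhonov minimizers at a fixed noise level *)

Section tikhonov_rate.
Context {R : realType} {Y : normedModType R} (A : boundedOp (ell1 R) Y).
Context (p K : R) (z : ell1 R) (phi : R -> R) (delta : R) (yd : Y).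
Hypotheses (p_gt1 : 1 < p) (K_gt0 : 0 < K)
  (phi_gt0 : forall t, 0 < t -> 0 < phi t)
  (phi_homo : forall s t, 0 <= s <= t -> phi s <= phi t)
  (phi_scale : forall s t, 0 <= t <= s -> t * phi s <= s * phi t)
  (variational_source : forall w : ell1 R,
     `|w - z| <= K * (`|w| - `|z| + phi `|A (w - z)|))
  (delta_gt0 : 0 < delta) (noise : `|A z - yd| <= delta).

Let p_gt0 : 0 < p. Proof. exact: lt_trans p_gt1. Qed.

Lemma phi_residual_le (w : ell1 R) :
  phi `|A (w - z)| <= (`|A w - yd| / delta + 1) * phi delta.
Proof.
have Awz : `|A (w - z)| <= `|A w - yd| + delta.
  rewrite linearB -(subrKA yd) (le_trans (ler_normD _ _)) // lerD2l.
  by rewrite distrC.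
have h0 : 0 <= `|A (w - z)| <= `|A w - yd| + delta by rewrite normr_ge0.
rewrite (le_trans (phi_homo h0)) // -(ler_pM2l delta_gt0).
have h1 : 0 <= delta <= `|A w - yd| + delta by rewrite ltW //= lerDr.
rewrite (le_trans (phi_scale h1)) // mulrA [delta * _]mulrDr mulr1
  mulrCA mulrV ?mulr1 //.
by rewrite unitfE gt_eqF.
Qed.

(** The minimizer is compared with the exact solution [z], whose misfit is at most [delta]. *)
Lemma minimizer_norm_le (alpha : R) (w : ell1 R) : 0 < alpha ->
  tikhonov_minimizer A p yd alpha w ->
  `|w| - `|z| <= delta `^ p / alpha * ((1 - (`|A w - yd| / delta) `^ p) / p).
Proof.
move=> alpha0 /(_ z); rewrite /tikhonov => min.
have noisep : `|A z - yd| `^ p <= delta `^ p.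
  by apply: ge0_ler_powR; rewrite ?nnegrE // ltW.
have -> : delta `^ p / alpha * ((1 - (`|A w - yd| / delta) `^ p) / p)
    = p^-1 * (delta `^ p - delta `^ p * (`|A w - yd| / delta) `^ p) / alpha.
  by ring.
rewrite -powRM ?divr_ge0 ?(ltW delta_gt0) // mulrCA mulfV ?gt_eqF // mulr1.
rewrite ler_pdivlMr //.
have : p^-1 * `|A z - yd| `^ p <= p^-1 * delta `^ p.
  by rewrite ler_wpM2l // invr_ge0 ltW.
lra.
Qed.

Lemma minimizer_dist_le (alpha : R) (w : ell1 R) : 0 < alpha ->
  tikhonov_minimizer A p yd alpha w ->
  `|w - z| <= K * (delta `^ p / alpha * ((1 - (`|A w - yd| / delta) `^ p) / p)
                   + (`|A w - yd| / delta + 1) * phi delta).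
Proof.
move=> alpha0 min; apply: (le_trans (variational_source w)).
by rewrite ler_pM2l // lerD ?minimizer_norm_le // phi_residual_le.
Qed.

(** Young's inequality for the product of [s] and 1. *)
Lemma le_powR_conjugate (s : R) : 0 <= s -> s <= s `^ p / p + (1 - p^-1).
Proof.
move=> s0; have q0 : 0 < 1 - p^-1 by rewrite subr_gt0 invf_lt1.
have := @conjugate_powR R s 1 p (1 - p^-1)^-1 s0 ler01 p_gt0.
by rewrite invr_gt0 invrK mulr1 powR1 mul1r; apply=> //; rewrite addrC subrK.
Qed.

Lemma apriori_rate (w : ell1 R) :
  tikhonov_minimizer A p yd (delta `^ p / phi delta) w ->
  `|w - z| <= 2 * K * phi delta.
Proof.
move=> min; have phid := phi_gt0 delta_gt0.
have dp : 0 < delta `^ p by rewrite powR_gt0.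
apply: (le_trans (minimizer_dist_le _ min)); first by rewrite divr_gt0.
rewrite [delta `^ p / _](_ : _ = phi delta); last first.
  by field; rewrite !gt_eqF.
rewrite [2 * K]mulrC -mulrA ler_pM2l //.
have s0 : 0 <= `|A w - yd| / delta by rewrite divr_ge0 // ltW.
(* The powers of [s] cancel: [(1 - s^p) / p + s + 1 <= 2], whence the constant [2 * K]. *)
have := ler_wpM2r (ltW phid) (le_powR_conjugate s0);
  move: (_ / delta) => s; lra.
Qed.

(* The variational inequality bounds |w| - |z| from below, while minimality
   bounds it from above by a negative multiple of delta^p / alpha as soon as
   the discrepancy exceeds tau delta. *)
Lemma discrepancy_parameter_le (tau alpha : R) (w : ell1 R) : 1 < tau ->
  0 < alpha -> tikhonov_minimizer A p yd alpha w -> tau * delta < `|A w - yd| ->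
  delta `^ p / alpha <= (tau + 1) / (tau - 1) * p * phi delta.
Proof.
move=> tau1 alpha0 min; rewrite -ltr_pdivlMr //.
have := le_trans (normr_ge0 _) (minimizer_dist_le alpha0 min).
rewrite pmulr_rge0 //; move: (_ / delta) => s.
have : 0 < delta `^ p / alpha by rewrite divr_gt0 // powR_gt0.
move: (_ / alpha) => B B0 h taus.
(* Since [s > tau > 1] and [p > 1], the power may be replaced by [s] itself. *)
have sp : s <= s `^ p by rewrite -[leLHS]powRr1 ?ler_powR ?ltW //; lra.
have {}h : B * (s `^ p - 1) <= p * (s + 1) * phi delta.
  rewrite -(ler_pM2l (_ : 0 < p^-1)) ?invr_gt0 // -!mulrA mulKf ?gt_eqF //; lra.
have tau0 : 0 < tau - 1 by rewrite subr_gt0.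
rewrite mulrAC -mulrA mulrAC ler_pdivlMr //.
have s1 : 0 < s + 1 by lra.
rewrite -(ler_pM2r s1).
have : B * (s - 1) <= B * (s `^ p - 1) by rewrite ler_pM2l //; lra.
(* The quotient [(s + 1) / (s - 1)] decreases for [s > 1], so it is at most its value at [tau]. *)
have : B * ((tau - 1) * (s + 1)) <= B * ((tau + 1) * (s - 1)).
  by rewrite ler_pM2l //; lra.
nra.
Qed.

Lemma discrepancy_rate (tau q alpha0 alpha : R) (w : ell1 R) : 1 < tau ->
  0 < q < 1 -> 0 < alpha0 -> tikhonov_minimizer A p yd alpha w ->
  sdp_choice A p yd tau q alpha0 delta alpha w ->
  `|w - z| <= K * ((tau + 1) / (tau - 1) / q + (tau + 1)) * phi delta.
Proof.
move=> tau1 /andP[q0 q1] alpha00 min [[j _ alphaE]] [w' min' /andP[wle w'gt]].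
have alpha1 : 0 < alpha by rewrite alphaE mulr_gt0 // exprn_gt0.
have alpha2 : 0 < alpha / q by rewrite divr_gt0.
apply: (le_trans (minimizer_dist_le alpha1 min)).
rewrite -[leRHS]mulrA ler_pM2l // [leRHS]mulrDl; apply: lerD; last first.
  rewrite ler_pM2r ?phi_gt0 // lerD2r ler_pdivrMr //.
(* The discrepancy still exceeds [tau * delta] at [alpha / q]; returning to [alpha] costs the factor
   [1 / q]. *)
have := discrepancy_parameter_le tau1 alpha2 min' w'gt.
rewrite invf_div mulrA => /(ler_wpM2r) hB.
set s := (_ / delta);
  have B0 : 0 < delta `^ p / alpha by rewrite divr_gt0 ?powR_gt0.
apply: (@le_trans _ _ (delta `^ p / alpha * p^-1)).
  rewrite ler_pM2l // ler_pdivrMr // mulVf ?gt_eqF //.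
  by rewrite gerBl powR_ge0.
have := hB (q * p)^-1; rewrite invr_ge0 mulr_ge0 ?(ltW q0) ?(ltW p_gt0)
  // => /(_ isT).
congr (_ <= _); field; rewrite ?gt_eqF //= ?subr_gt0 //.
Qed.

End tikhonov_rate.

Theorem corollary5p6 (R : realType) (Z : completeNormedModType R)
  (hZ : separable Z)
  (A : boundedOp (ell1 R) (dual Z))
  (A_inj : injective A)
  (A_wstar : weak_star_continuous A)
  (mu : R) (hmu : 0 <= mu < 1) (gamma : nat -> R)
  (hsource : forall n : nat, (0 < n)%N ->
     forall xi : nat -> R, bounded_fun (xi : nat -> R^o) ->
       (forall k, (k < n)%N -> -1 <= xi k <= 1) ->
       (forall k, (n <= k)%N -> xi k = 0) ->
       exists eta : dual (dual Z),
         [/\ proj_seq n (ell1_dual_seq (adjoint A eta)) = xi,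
             forall k, (n <= k)%N ->
               `|ell1_dual_seq (adjoint A eta) k
                 - proj_seq n (ell1_dual_seq (adjoint A eta)) k| <= mu
           & `|eta| <= gamma n])
  (p : R) (hp : 1 < p) (xdag : ell1 R) (y : dual Z) (hy : y = A xdag)
  (phi : R -> R) (hphi : forall t, 0 <= t -> phi t = rate_function xdag gamma t) :
  [/\ index_function phi,
      concave_function phi,
      exists C dbar : R, [/\ 0 < C, 0 < dbar &
        forall (delta : R) (ydelta : dual Z) (x : ell1 R),
          0 < delta <= dbar -> `|y - ydelta| <= delta ->
          tikhonov_minimizer A p ydelta (delta `^ p / phi delta) x ->
          `|x - xdag| <= C * phi delta]
    & forall tau q alpha0 : R, 1 < tau -> 0 < q < 1 -> 0 < alpha0 ->
      exists C dbar : R, [/\ 0 < C, 0 < dbar &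
        forall (delta alpha : R) (ydelta : dual Z) (x : ell1 R),
          0 < delta <= dbar -> `|y - ydelta| <= delta ->
          tikhonov_minimizer A p ydelta alpha x ->
          sdp_choice A p ydelta tau q alpha0 delta alpha x ->
          `|x - xdag| <= C * phi delta]].

Proof.
have /andP[mu0 mu1] := hmu.
(* The source condition is applied to the signs of [d], cut off after [n] components. *)
have source n (d : ell1 R) : (0 < n)%N -> exists eta : dual (dual Z),
    [/\ forall k, (k < n)%N ->
          ell1_dual_seq (adjoint A eta) k = Num.sg (d k),
        forall k, (n <= k)%N -> `|ell1_dual_seq (adjoint A eta) k| <= mu
      & `|eta| <= gamma n].
  move=> n0; pose xi := proj_seq n (fun k => Num.sg (d k)).
  have xi1 k : `|xi k| <= 1.
    by rewrite /xi /proj_seq; case: ifP => _; rewrite ?normr0 // normr_sg;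
      case: (_ != _).
  have [||k nk|eta [head tail etag]] := hsource n n0 xi.
  - by exists 1; split=> // M M1 k _ /=; rewrite (le_trans (xi1 k)) // ltW.
  - by move=> k _; rewrite -ler_norml.
  - by rewrite /xi /proj_seq ltnNge nk.
  exists eta; split=> // k nk.
    by have := congr1 (fun f => f k) head; rewrite /xi /proj_seq nk.
  by have := tail k nk; rewrite /proj_seq ltnNge nk subr0.
(* For the first unit vector, [eta (A (ell1_unit 0)) = 1], so [1 <= gamma n * |A (ell1_unit 0)|].
   This supplies the uniform lower bound on [gamma]. *)
have gamma_ge n : (0 < n)%N ->
    0 < `|A (ell1_unit 0)| /\ `|A (ell1_unit 0)|^-1 <= gamma n.
  move=> n0; have [eta [head _ etag]] := source n (ell1_unit 0) n0.
  have := opnormP eta (A (ell1_unit 0)).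
  have -> : eta (A (ell1_unit 0)) = 1
    by have := head 0%N n0; rewrite /ell1_dual_seq /= sgr1.
  rewrite normr1 => eta1.
  have Ae0 : 0 < `|A (ell1_unit 0)|.
    rewrite lt_neqAle normr_ge0 andbT eq_sym; apply: contraPneq eta1 => ->.
    by rewrite mulr0 ler10.
  split=> //; rewrite -div1r ler_pdivrMr // (le_trans eta1) //.
  by rewrite ler_wpM2r.
have [c0 _] := gamma_ge 1%N isT.
have {}gamma_ge n (n0 : (0 < n)%N) := (gamma_ge n n0).2.
have c1 : 0 < `|A (ell1_unit 0)|^-1 by rewrite invr_gt0.
set K := (1 + mu) / (1 - mu).
have K0 : 0 < K by rewrite divr_gt0 ?subr_gt0 // ltr_pwDl.
have vsc (w : ell1 R) :
    `|w - xdag| <= K * (`|w| - `|xdag| + phi `|A (w - xdag)|).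
  have mu1' : 0 < 1 - mu by rewrite subr_gt0.
  have mu2 : 0 < 1 + mu by rewrite ltr_pwDl.
  (* With [phi] isolated, it suffices to prove the inequality for each [n], with its own [eta], and
     take the infimum. *)
  rewrite /K mulrAC ler_pdivlMr // mulrC -ler_pdivrMl // -lerBlDl hphi //.
  apply: le_rate_function => n n0; rewrite lerBlDl ler_pdivrMl //.
  have [eta [head tail etag]] := source n (w - xdag) n0.
  exact: source_variational_le hmu head tail etag.
have phi_gt0 t : 0 < t -> 0 < phi t.
  by move=> t0; rewrite hphi ?ltW // (rate_function_gt0 _ c1 gamma_ge).
have phi_homo s t : 0 <= s <= t -> phi s <= phi t.
  move=> /[dup] /andP[s0 st]; rewrite !hphi //; last exact: le_trans st.
  exact: (rate_function_homo _ c1 gamma_ge).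
have phi_scale s t : 0 <= t <= s -> t * phi s <= s * phi t.
  move=> /[dup] /andP[t0 ts]; rewrite !hphi //; last exact: le_trans ts.
  exact: (rate_function_scale _ c1 gamma_ge).
split.
- exact: rate_index_function c1 gamma_ge hphi.
- exact: rate_concave_function c1 gamma_ge hphi.
(* The bound holds for every [delta > 0], so any positive [dbar] will do; likewise for the
   discrepancy principle. *)
- exists (2 * K), 1; split=> //; first by rewrite mulr_gt0.
  move=> delta yd x /andP[d0 _]; rewrite hy => noise min.
  by have := apriori_rate hp K0 phi_gt0 phi_homo phi_scale vsc d0 noise min.
- move=> tau q alpha0 tau1 q01 alpha00.
  exists (K * ((tau + 1) / (tau - 1) / q + (tau + 1))), 1; split=> //.
    have /andP[q0 _] := q01.
    have tau0 : 0 < tau + 1 by lra.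
    by rewrite mulr_gt0 // addr_gt0 // !divr_gt0 ?subr_gt0.
  move=> delta alpha yd x /andP[d0 _]; rewrite hy => noise min sdp.
  by have := discrepancy_rate hp K0 phi_gt0 phi_homo phi_scale vsc d0
    noise tau1 q01 alpha00 min sdp.
Qed.
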